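(* Let $l\ge1$, $n\ge 1$ and $d\ge n$ be integers and let $\mathcal A=\{a_1<\dots<a_l\}$ be a totally ordered alphabet. Then every word over $\mathcal A$ of length at least $$256\, l\,(nd)^{2\log_2(nd)+10}d^2$$ either contains a subword of the form $u^d$ for some nonempty word $u$, or is $n$-divisible.
   Context: Words are finite sequences of letters; a subword means a contiguous factor. Two words $u,v$ are called comparable if neither is a prefix of the other. For comparable $u,v$ write $u\succ v$ if at the first position where they differ the letter of $u$ is larger. A word $W$ is $n$-divisible if it contains a subword $u_1u_2\cdots u_n$ with nonempty $u_i$ and $u_1\succ u_2\succ\dots\succ u_n$. *)

(* Defs.v *)
(* words are lists of natural numbers; the alphabet
   {a_1 < ... < a_l} is represented as {0,...,l-1} with the usual order. *)
From Stdlib Require Import Reals Lra Lia Arith List.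
Import ListNotations.

Definition word := list nat.

Definition is_prefix (u v : word) : Prop := exists w, v = u ++ w.

Definition comparable (u v : word) : Prop := ~ is_prefix u v /\ ~ is_prefix v u.

Definition succ_word (u v : word) : Prop :=
  comparable u v /\
  exists (p : word) (a b : nat) (s t : word),
    u = p ++ a :: s /\ v = p ++ b :: t /\ b < a.

Definition subword (u W : word) : Prop := exists x y, W = x ++ u ++ y.

Definition wpow (u : word) (d : nat) : word := concat (repeat u d).

Definition n_divisible (n : nat) (W : word) : Prop :=
  exists us : list word,
    length us = n /\
    Forall (fun u => u <> []) us /\
    (forall i, S i < n -> succ_word (nth i us []) (nth (S i) us [])) /\
    subword (concat us) W.

Definition log2R (x : R) : R := ln x / ln 2.

(* Main.v *)
(** At scale [k], a lexicographic descent between the length-[k] factors at [n]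
    positions that are pairwise [k] apart gives an [n]-division.  Otherwise, rank
    each position by the longest such descent starting there: only [n - 1] ranks
    occur, and two positions of equal rank at distance at least [k] never decrease.
    Cutting an interval with [v] distinct [k]-factors into about [n v] blocks, some
    block exhibits no new pair (rank, factor), and in its bulk the factor depends on
    the rank alone, so at most [n - 1] factors remain.  An interval with at most
    [n - 1] distinct [k]-factors has at most [(n - 1)^2] distinct [2 k]-factors, so
    each doubling of the scale costs a factor [n^3] in length.  Once [k >= n d], the
    pigeonhole principle gives [n] disjoint copies of one word of length at least
    [n d]; its first [n] tails are pairwise comparable unless it contains a [d]-th
    power, and taking the tails in decreasing order from successive copies gives an
    [n]-division. *)

Require Import Defs.
From Stdlib Require Import Reals Lra Lia Arith List Permutation Sorted Classical.
Import ListNotations.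

(** * Lexicographic comparison of words *)

(** The second half of [succ_word]; comparability follows from it, see [lex_gt_succ_word]. *)
Definition lex_gt (u v : word) : Prop :=
  exists (p : word) (a b : nat) (s t : word),
    u = p ++ a :: s /\ v = p ++ b :: t /\ b < a.

Lemma lex_gt_cons (c : nat) (u v : word) : lex_gt u v -> lex_gt (c :: u) (c :: v).
Proof.
  intros (p & a & b & s & t & -> & -> & ?).
  exists (c :: p), a, b, s, t; auto.
Qed.

Lemma is_prefix_cons (c : nat) (u v : word) :
  is_prefix u v -> is_prefix (c :: u) (c :: v).
Proof. intros [w ->]. exists w; auto. Qed.

Lemma lex_gt_or_prefix (u v : word) :
  lex_gt u v \/ lex_gt v u \/ is_prefix u v \/ is_prefix v u.
Proof.
  revert v; induction u as [|a u IH]; intros [|b v].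
  - right; right; left; exists []; auto.
  - right; right; left; exists (b :: v); auto.
  - right; right; right; exists (a :: u); auto.
  - destruct (Nat.lt_trichotomy a b) as [H | [<- | H]].
    + right; left; exists [], b, a, v, u; auto.
    + destruct (IH v) as [H | [H | [H | H]]];
        auto using lex_gt_cons, is_prefix_cons.
    + left; exists [], a, b, u, v; auto.
Qed.

Lemma is_prefix_length (u v : word) : is_prefix u v -> length u <= length v.
Proof. intros [w ->]. rewrite length_app; lia. Qed.

Lemma is_prefix_same_length (u v : word) :
  is_prefix u v -> length u = length v -> u = v.
Proof.
  intros [[|c w] ->]; rewrite ?app_nil_r; auto.
  rewrite length_app; simpl; lia.
Qed.

Lemma lex_gt_total (u v : word) :
  length u = length v -> ~ lex_gt u v -> ~ lex_gt v u -> u = v.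
Proof.
  intros E H1 H2.
  destruct (lex_gt_or_prefix u v) as [H | [H | [H | H]]];
    [tauto | tauto | | symmetry]; apply is_prefix_same_length; auto.
Qed.

(** The first differing letters survive any extension to the right, and they prevent either extended
    word from being a prefix of the other. *)
Lemma lex_gt_succ_word (u v y z : word) :
  lex_gt u v -> succ_word (u ++ y) (v ++ z).
Proof.
  intros (p & a & b & s & t & -> & -> & H).
  rewrite <- !app_assoc; simpl.
  split; [split|]; [intros [w E] | intros [w E] | exists p, a, b, (s ++ y), (t ++ z); auto].
  all: rewrite <- app_assoc in E; apply app_inv_head in E; simpl in E;
    injection E; intros; lia.
Qed.

(** * Factors and their occurrences *)

Definition factor (W : word) (i k : nat) : word := firstn k (skipn i W).

Lemma length_factor (W : word) (i k : nat) :
  i + k <= length W -> length (factor W i k) = k.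
Proof. intros H. unfold factor. rewrite length_firstn, length_skipn. lia. Qed.

Lemma firstn_add {A} (j k : nat) (w : list A) :
  firstn (j + k) w = firstn j w ++ firstn k (skipn j w).
Proof.
  revert w; induction j as [|j IH]; intros [|x w]; simpl; auto.
  - now destruct k.
  - now rewrite IH.
Qed.

Lemma factor_add (W : word) (i j k : nat) :
  factor W i (j + k) = factor W i j ++ factor W (i + j) k.
Proof.
  unfold factor. rewrite firstn_add, skipn_skipn, (Nat.add_comm j i). auto.
Qed.

Definition occurs_at (W : word) (p : nat) (w : word) : Prop :=
  exists y, skipn p W = w ++ y.

Lemma factor_occurs (W : word) (i k : nat) : occurs_at W i (factor W i k).
Proof. exists (skipn k (skipn i W)). symmetry; apply firstn_skipn. Qed.

Lemma occurs_at_skipn (W u : word) (p o : nat) :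
  o <= length u -> occurs_at W p u -> occurs_at W (p + o) (skipn o u).
Proof.
  intros Ho [y E]. exists y.
  rewrite (Nat.add_comm p o), <- skipn_skipn, E, skipn_app.
  now replace (o - length u) with 0 by lia.
Qed.

(** * Descents and n-divisions *)

(** Gaps between consecutive words are allowed. The first position and first word are indices, so
    that a descent can be prolonged on the left. *)
Inductive descent (W : word) : nat -> nat -> word -> Prop :=
| descent_one p w : occurs_at W p w -> w <> [] -> descent W 1 p w
| descent_cons n p w p' w' :
    occurs_at W p w -> lex_gt w w' -> p + length w <= p' ->
    descent W n p' w' -> descent W (S n) p w.

(** Each gap is glued to the end of the word before it, which makes the words adjacent and keeps the
    comparisons. Here [z] is the gap after [w]. *)
Lemma descent_split (W : word) (n p : nat) (w : word) :
  descent W n p w ->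
  exists z us y,
    skipn p W = concat ((w ++ z) :: us) ++ y /\
    S (length us) = n /\
    Forall (fun u => u <> []) ((w ++ z) :: us) /\
    (forall i, S i < n ->
       succ_word (nth i ((w ++ z) :: us) []) (nth (S i) ((w ++ z) :: us) [])).
Proof.
  induction 1 as [p w [y E] Hw | n p w p' w' [y0 E] Hgt Hle _ (z & us & y & E' & Hl & Hne & Hs)].
  - exists [], [], y. simpl. rewrite !app_nil_r.
    split; [|split; [|split]]; auto; intros; lia.
  (* The gap between the end of [w], at [p + length w], and [p']. *)
  - exists (firstn (p' - p - length w) y0), ((w' ++ z) :: us), y.
    split; [|split; [|split]].
    + cbn [concat]. cbn [concat] in E'. rewrite <- app_assoc, <- E'.
      rewrite <- (firstn_skipn (p' - p) (skipn p W)) at 1.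
      rewrite skipn_skipn, Nat.sub_add by lia.
      rewrite E, firstn_app, firstn_all2 by lia. auto.
    + simpl; lia.
    + constructor; auto.
      destruct Hgt as (q & a & b & s & t & -> & _). now destruct q.
    + intros [|k] Hk.
      * now apply lex_gt_succ_word.
      * apply (Hs k); lia.
Qed.

Lemma descent_n_divisible (W : word) (n p : nat) (w : word) :
  descent W n p w -> n_divisible n W.
Proof.
  intros H. destruct (descent_split _ _ _ _ H) as (z & us & y & E & Hl & Hne & Hs).
  exists ((w ++ z) :: us). split; [|split; [|split]]; auto.
  exists (firstn p W), y. now rewrite <- E, firstn_skipn.
Qed.

(** * Ranks and intervals with few values *)

(** Every stage that fails loses an element of [L] for good, so at most [length L] stages fail. *)
Lemma decreasing_sets_stabilize {A} (Q : nat -> A -> Prop) (L : list A) :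
  (forall t x, Q (S t) x -> Q t x) ->
  exists t, t <= length L /\ forall x, In x L -> Q t x -> Q (S t) x.
Proof.
  remember (length L) as m eqn:Em. revert L Em Q.
  induction m as [|m IH]; intros L Em Q Hdec.
  - exists 0. split; auto. destruct L; [intros ? [] | discriminate].
  - destruct (classic (forall x, In x L -> Q 0 x -> Q 1 x)) as [H | H].
    + exists 0. split; [lia | auto].
    + apply not_all_ex_not in H. destruct H as [x H].
      apply imply_to_and in H. destruct H as [Hx H].
      apply imply_to_and in H. destruct H as [_ H1].
      destruct (in_split _ _ Hx) as (L1 & L2 & ->).
      rewrite length_app in Em. simpl in Em.
      destruct (IH (L1 ++ L2)) with (Q := fun t => Q (S t)) as (t & Ht & HS).
      * rewrite length_app; lia.
      * auto.
      * exists (S t). split; [lia|]. intros y Hy HQy.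
        assert (Hx' : ~ Q (S t) x).
        { clear -H1 Hdec. induction t; auto. }
        apply in_app_iff in Hy. simpl in Hy.
        destruct Hy as [Hy | [<- | Hy]]; [| tauto |]; apply HS; auto;
          apply in_app_iff; auto.
Qed.

Lemma values_by_rank {A} (f : nat -> A) (P : nat -> nat -> Prop) (J : nat -> Prop) (q : nat) :
  (forall c i j, J i -> J j -> P c i -> P c j -> f i = f j) ->
  (forall i, J i -> exists c, c < q /\ P c i) ->
  exists V, length V <= q /\ forall i, J i -> In (f i) V.
Proof.
  revert J; induction q as [|q IH]; intros J Hf HJ.
  - exists []. split; auto. intros i Hi. destruct (HJ i Hi) as (c & ? & _). lia.
  - destruct (IH (fun i => J i /\ ~ P q i)) as (V & HV & HI).
    + intros c i j [] []. now apply Hf.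
    + intros i [Hi Hq]. destruct (HJ i Hi) as (c & Hc & HP).
      exists c. split; auto.
      assert (c <> q) by congruence. lia.
    + destruct (classic (exists i, J i /\ P q i)) as [(i0 & Hi0 & Hq) | H].
      * exists (f i0 :: V). split; [simpl; lia|]. intros i Hi.
        destruct (classic (P q i)) as [Hi' | Hi'].
        -- left. eapply Hf; eauto.
        -- right. auto.
      * exists V. split; [lia|]. intros i Hi. apply HI. split; auto.
        intros Hq. apply H. eauto.
Qed.

Lemma maximal_rank (P : nat -> Prop) (q : nat) :
  P 0 -> ~ P q -> exists c, c < q /\ P c /\ ~ P (S c).
Proof.
  intros H0. induction q as [|q IH]; intros Hq; [tauto|].
  destruct (classic (P q)) as [H | H].
  - exists q; auto.
  - destruct (IH H) as (c & ? & ?). exists c; split; auto.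
Qed.

(** [R c i] says that the rank of [i] is at least [c]. Among [q * length V + 1] blocks of length
    [m + k], some block has all its pairs (rank, value) recurring in later blocks; its first [m]
    positions form the subinterval. *)
Lemma few_values_subinterval {A} (f : nat -> A) (gt : A -> A -> Prop)
    (R : nat -> nat -> Prop) (k q a e m : nat) (V : list A) :
  (forall i j, a <= i < e -> a <= j < e ->
     ~ gt (f i) (f j) -> ~ gt (f j) (f i) -> f i = f j) ->
  (forall i, a <= i < e -> In (f i) V) ->
  (forall i, a <= i < e -> R 0 i) ->
  (forall i, a <= i < e -> ~ R q i) ->
  (forall c i j, a <= i -> j < e -> i + k <= j -> gt (f i) (f j) -> R c j -> R (S c) i) ->
  a + (q * length V + 1) * (m + k) <= e ->
  exists a', a <= a' /\ a' + m <= e /\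
    exists V', length V' <= q /\ forall i, a' <= i < a' + m -> In (f i) V'.
Proof.
  intros Htot HV HR0 HRq HRS He.
  set (pos t := a + t * (m + k)).
  (* The pairs that occur from block [t] onwards: a set that shrinks as [t] grows. *)
  set (seen t (x : nat * A) :=
         exists j, pos t <= j < e /\ R (fst x) j /\ f j = snd x).
  destruct (decreasing_sets_stabilize seen (list_prod (seq 0 q) V)) as (t & Ht & Hst).
  { intros t x (j & Hj & H). exists j. split; auto. unfold pos in *. simpl in Hj. lia. }
  rewrite length_prod, length_seq in Ht.
  assert (Ht' : pos (S t) <= e).
  { unfold pos. transitivity (a + (q * length V + 1) * (m + k)); auto.
    apply Nat.add_le_mono_l, Nat.mul_le_mono_r. lia. }
  assert (Hpos : pos (S t) = pos t + m + k) by (unfold pos; simpl; lia).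
  assert (Ha : a <= pos t) by (unfold pos; lia).
  exists (pos t). split; auto. split; [lia|].
  apply values_by_rank with (P := fun c i => R c i /\ ~ R (S c) i /\ c < q).
  (* The pair of [i] recurs at some [i'] in a later block, at distance at least [k] from [j]. If
     [f j] exceeded [f i], then [j] would have rank at least [S c]. *)
  - assert (Hno : forall c i j, pos t <= i < pos t + m -> pos t <= j < pos t + m ->
        R c i -> c < q -> ~ R (S c) j -> ~ gt (f j) (f i)).
    { intros c i j Hi Hj HRi Hc HRj Hgt.
      destruct (Hst (c, f i)) as (i' & Hi' & HRi' & Ei).
      - apply in_prod; [apply in_seq; lia | apply HV; lia].
      - exists i. simpl. repeat split; auto; lia.
      - simpl in *. apply HRj. apply HRS with i'; auto; try lia. now rewrite Ei. }
    intros c i j Hi Hj (HRi & HRi' & Hc) (HRj & HRj' & _).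
    apply Htot; try lia; eauto.
  - intros i Hi.
    destruct (maximal_rank (fun c => R c i) q) as (c & Hc & H & H').
    + apply HR0; lia.
    + apply HRq; lia.
    + exists c. auto.
Qed.

(** * Tails of a word and periodicity *)

(** If [v] is a prefix of [w ++ v], then [w ++ v] has period [length w], so it starts with as many
    copies of [w] as fit. *)
Lemma power_prefix (w v : word) (m : nat) :
  is_prefix v (w ++ v) -> m * length w <= length w + length v ->
  is_prefix (wpow w m) (w ++ v).
Proof.
  intros [z Ez]. induction m as [|m IH]; intros Hm.
  - exists (w ++ v). auto.
  - simpl in Hm. destruct IH as [y Ey]; [lia|].
    assert (El : length (wpow w m) = m * length w).
    { clear. unfold wpow. induction m; simpl; auto. rewrite length_app; lia. }
    exists (skipn (m * length w) v).
    change (wpow w (S m)) with (w ++ wpow w m).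
    rewrite <- app_assoc. f_equal.
    assert (E : firstn (m * length w) (v ++ z) = firstn (m * length w) (wpow w m ++ y))
      by (f_equal; congruence).
    rewrite !firstn_app, El, Nat.sub_diag in E.
    replace (m * length w - length v) with 0 in E by lia.
    simpl in E. rewrite !app_nil_r in E.
    rewrite (firstn_all2 (wpow w m)) in E by lia.
    rewrite <- E. symmetry; apply firstn_skipn.
Qed.

(** If the tail at [j] is a prefix of the tail at [i], the latter has period [j - i < n], and
    [n * d <= length u] leaves room for [d] periods. *)
Lemma tails_comparable_or_power (u : word) (n d i j : nat) :
  n * d <= length u -> i < j -> j < n ->
  lex_gt (skipn i u) (skipn j u) \/ lex_gt (skipn j u) (skipn i u) \/
  exists w, w <> [] /\ is_prefix (wpow w d) (skipn i u).
Proof.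
  intros Hu Hij Hj.
  assert (Hjd : j * d + d <= length u) by nia.
  destruct (Nat.eq_dec d 0) as [-> | Hd].
  { right; right. exists [0]. split; [discriminate|]. now exists (skipn i u). }
  assert (Hju : j <= length u) by nia.
  assert (Ei : skipn i u = firstn (j - i) (skipn i u) ++ skipn j u).
  { rewrite <- (firstn_skipn (j - i) (skipn i u)) at 1.
    now rewrite skipn_skipn, Nat.sub_add by lia. }
  assert (Hlw : length (firstn (j - i) (skipn i u)) = j - i)
    by (rewrite length_firstn, length_skipn; lia).
  destruct (lex_gt_or_prefix (skipn i u) (skipn j u)) as [H | [H | [H | H]]]; auto.
  - apply is_prefix_length in H. rewrite !length_skipn in H. lia.
  - right; right. exists (firstn (j - i) (skipn i u)). split.
    + intros E. rewrite E in Hlw. simpl in Hlw. lia.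
    + rewrite Ei at 2. apply power_prefix.
      * now rewrite <- Ei.
      * rewrite Hlw, length_skipn. nia.
Qed.

(** * From disjoint copies of a word to an n-division *)

(** Hamiltonian path in a tournament: [x] is inserted before the first element that it beats. This
    orders the tails without proving [lex_gt] transitive. *)
Lemma tournament_path {A} (gt : A -> A -> Prop) (L : list A) :
  NoDup L ->
  (forall x y, In x L -> In y L -> x <> y -> gt x y \/ gt y x) ->
  exists L', Permutation L L' /\ Sorted gt L'.
Proof.
  induction L as [|x L IH]; intros HN Ht.
  { exists []; auto. }
  inversion_clear HN as [|? ? Hx HN'].
  destruct IH as (L' & HP & HS); auto.
  { intros; apply Ht; simpl; auto. }
  assert (Hx' : forall y, In y L' -> gt x y \/ gt y x).
  { intros y Hy. apply Permutation_sym, Permutation_in with (x := y) in HP; auto.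
    apply Ht; simpl; auto. intros ->; auto. }
  (* The new head is [x] or the old head; the last clause lets the preceding element beat it in
     either case. *)
  assert (H : exists L'', Permutation (x :: L') L'' /\ Sorted gt L'' /\
             (forall z, HdRel gt z L' -> gt z x -> HdRel gt z L'')).
  { clear -HS Hx'. induction L' as [|y L' IH].
    - exists [x]. repeat split; auto.
    - inversion_clear HS as [|? ? HS' Hd].
      destruct (Hx' y) as [H | H]; [simpl; auto | |].
      + exists (x :: y :: L'). repeat split; auto.
      + destruct IH as (L'' & HP & HS'' & Hd''); auto.
        { intros; apply Hx'; simpl; auto. }
        exists (y :: L''). split; [|split].
        * rewrite perm_swap. auto.
        * auto.
        * intros z Hz _. inversion_clear Hz. auto. }
  destruct H as (L'' & HP' & HS' & _). exists L''. split; auto.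
  now rewrite HP.
Qed.

(** Each tail ends where its copy of [u] ends, hence before the next copy starts, whatever the
    offsets are. *)
Lemma copies_descent (W u : word) (os xs : list nat) (o x : nat) :
  length os <= length xs ->
  Forall (fun y => occurs_at W y u) (x :: xs) ->
  StronglySorted (fun y z => y + length u <= z) (x :: xs) ->
  Forall (fun y => y < length u) (o :: os) ->
  Sorted (fun y z => lex_gt (skipn y u) (skipn z u)) (o :: os) ->
  descent W (S (length os)) (x + o) (skipn o u).
Proof.
  revert xs o x; induction os as [|o' os IH]; intros [|x' xs] o x Hl Hx Hsx Ho Hso;
    try (simpl in Hl; lia); inversion_clear Hx as [|? ? Hx0 Hx'];
    inversion_clear Ho as [|? ? Ho0 Ho'];
    inversion_clear Hsx as [|? ? Hsx' Hfx]; inversion_clear Hso as [|? ? Hso' Hd];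
    assert (Hocc : occurs_at W (x + o) (skipn o u)) by (apply occurs_at_skipn; auto; lia).
  1, 2: apply descent_one; auto;
    intros E; apply (f_equal (@length nat)) in E; rewrite length_skipn in E;
    simpl in E; lia.
  - inversion_clear Hd. inversion_clear Hfx.
    apply descent_cons with (x' + o') (skipn o' u); auto.
    + rewrite length_skipn. lia.
    + apply IH with xs; simpl in Hl; auto; lia.
Qed.

Lemma copies_divisible_or_power (W u : word) (n d : nat) (xs : list nat) :
  1 <= n -> n <= length u -> n * d <= length u -> n <= length xs ->
  Forall (fun y => occurs_at W y u) xs ->
  StronglySorted (fun y z => y + length u <= z) xs ->
  (exists w, w <> [] /\ subword (wpow w d) W) \/ n_divisible n W.
Proof.
  intros Hn Hnu Hu Hxs Hocc Hsort.
  destruct (classic (exists w, w <> [] /\ subword (wpow w d) W)) as [H | Hpow]; auto.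
  right.
  destruct xs as [|x xs]; [simpl in Hxs; lia|].
  assert (Htail : forall i j, i < j -> j < n ->
      lex_gt (skipn i u) (skipn j u) \/ lex_gt (skipn j u) (skipn i u)).
  { intros i j Hij Hj.
    destruct (tails_comparable_or_power u n d i j) as [H | [H | (w & Hw & z & E)]]; auto.
    exfalso. apply Hpow. exists w. split; auto.
    inversion_clear Hocc as [|? ? [y Ey] _].
    (* The power starts [i] letters into the first copy of [u]. *)
    exists (firstn x W ++ firstn i u), (z ++ y).
    rewrite <- (firstn_skipn x W) at 1. rewrite Ey.
    rewrite <- (firstn_skipn i u) at 1. rewrite E.
    now rewrite <- !app_assoc. }
  destruct (tournament_path (fun i j => lex_gt (skipn i u) (skipn j u)) (seq 0 n))
    as (os & HP & HS).
  - apply seq_NoDup.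
  - intros i j Hi Hj Hne. apply in_seq in Hi, Hj.
    destruct (Nat.lt_ge_cases i j); [apply Htail | apply or_comm, Htail]; lia.
  - assert (Hlen := Permutation_length HP). rewrite length_seq in Hlen.
    assert (Hos : Forall (fun y => y < length u) os).
    { apply Forall_forall. intros y Hy.
      apply (Permutation_in _ (Permutation_sym HP)), in_seq in Hy. lia. }
    destruct os as [|o os]; [simpl in Hlen; lia|].
    apply descent_n_divisible with (p := x + o) (w := skipn o u).
    rewrite Hlen. apply copies_descent with xs; auto. simpl in *; lia.
Qed.

(** * Pigeonhole on separated positions *)

Lemma StronglySorted_filter {A} (P : A -> A -> Prop) (f : A -> bool) (xs : list A) :
  StronglySorted P xs -> StronglySorted P (filter f xs).
Proof.
  induction 1 as [|x xs _ IH H]; simpl; [constructor|].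
  destruct (f x); auto. constructor; auto.
  apply Forall_forall. intros y Hy. apply filter_In in Hy.
  eapply Forall_forall in H; [exact H | tauto].
Qed.

(** Either [v] is taken more than [q] times, or discarding its positions costs at most [q]. Passing
    to sublists keeps the positions separated. *)
Lemma sorted_pigeonhole (f : nat -> word) (V : list word) (q : nat)
    (P : nat -> nat -> Prop) (xs : list nat) :
  StronglySorted P xs -> (forall x, In x xs -> In (f x) V) ->
  length V * q < length xs ->
  exists v ys, q < length ys /\ incl ys xs /\ StronglySorted P ys /\
    forall y, In y ys -> f y = v.
Proof.
  revert xs; induction V as [|v V IH]; intros xs HS HV Hl.
  { destruct xs as [|x xs]; [simpl in Hl; lia|]. destruct (HV x); simpl; auto. }
  set (is_v x := if list_eq_dec Nat.eq_dec (f x) v then true else false).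
  destruct (Nat.lt_ge_cases q (length (filter is_v xs))) as [H | H].
  - exists v, (filter is_v xs). repeat split; auto using StronglySorted_filter, incl_filter.
    intros y Hy. apply filter_In in Hy. destruct Hy as [_ Hy]. unfold is_v in Hy.
    destruct (list_eq_dec Nat.eq_dec (f y) v); congruence.
  - destruct (IH (filter (fun x => negb (is_v x)) xs)) as (w & ys & Hq & Hi & Hys & Hw).
    + now apply StronglySorted_filter.
    + intros x Hx. apply filter_In in Hx. destruct Hx as [Hx Hv]. unfold is_v in Hv.
      destruct (list_eq_dec Nat.eq_dec (f x) v) as [|Hne]; [discriminate|].
      destruct (HV x Hx); [congruence | auto].
    + assert (E := filter_length is_v xs). simpl in Hl. lia.
    + exists w, ys. repeat split; auto.
      intros y Hy. apply Hi, filter_In in Hy. tauto.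
Qed.

Lemma StronglySorted_progression (a k m s : nat) :
  StronglySorted (fun y z => y + k <= z) (map (fun t => a + t * k) (seq s m)).
Proof.
  revert s; induction m as [|m IH]; intros s; simpl; constructor; auto.
  apply Forall_forall. intros z Hz. apply in_map_iff in Hz.
  destruct Hz as (t & <- & Ht). apply in_seq in Ht. nia.
Qed.

(** * Induction on the scale *)

Lemma few_long_factors (W : word) (n d k a len : nat) (V : list word) :
  1 <= n -> n <= d -> n * d <= k -> length V < n -> n * n * k <= len ->
  a + len + k <= length W + 1 ->
  (forall i, a <= i < a + len -> In (factor W i k) V) ->
  (exists w, w <> [] /\ subword (wpow w d) W) \/ n_divisible n W.
Proof.
  intros Hn Hd Hk HV Hlen Ha HI.
  assert (Hin : forall x, In x (map (fun t => a + t * k) (seq 0 (n * n))) ->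
                  a <= x < a + len).
  { intros x Hx. apply in_map_iff in Hx. destruct Hx as (t & <- & Ht).
    apply in_seq in Ht. nia. }
  (* Of [n * n] positions with at most [n - 1] factors, more than [n - 1] share one factor, since
     [(n - 1) * (n - 1) < n * n]. *)
  destruct (sorted_pigeonhole (fun i => factor W i k) V (n - 1)
              (fun y z => y + k <= z) (map (fun t => a + t * k) (seq 0 (n * n))))
    as (u & ys & Hq & Hi & HS & Hu).
  - apply StronglySorted_progression.
  - auto.
  - rewrite length_map, length_seq. nia.
  - assert (Hlu : length u = k).
    { destruct ys as [|y ys]; [simpl in Hq; lia|].
      rewrite <- (Hu y) by (simpl; auto). apply length_factor.
      specialize (Hin y (Hi y (or_introl eq_refl))). lia. }
    apply copies_divisible_or_power with u ys; rewrite ?Hlu; auto; try lia; try nia.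
    apply Forall_forall. intros y Hy. rewrite <- (Hu y Hy). apply factor_occurs.
Qed.

(* The term 4 * k absorbs the positions lost at the ends of the intervals. *)
Lemma few_factors (W : word) (n d s k a len : nat) (V : list word) :
  1 <= n -> n <= d -> 1 <= k -> n * d <= 2 ^ s * k -> length V < n ->
  n ^ (3 * s) * (n * n + 4) * 2 ^ s * k <= len + 4 * k ->
  a + len + k <= length W + 1 ->
  (forall i, a <= i < a + len -> In (factor W i k) V) ->
  (exists w, w <> [] /\ subword (wpow w d) W) \/ n_divisible n W.
Proof.
  intros Hn Hd. revert k a len V.
  induction s as [|s IH]; intros k a len V Hk HN HV Hlen Ha HI.
  { simpl in HN, Hlen. apply few_long_factors with k a len V; auto; lia. }
  destruct (classic (n_divisible n W)) as [Hdiv | Hdiv]; auto.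
  (* The bound for scale [2 * k] with [s] doublings left; [B - 8 * k] is the length it asks for, as
     [8 * k = 4 * (2 * k)]. *)
  set (B := n ^ (3 * s) * (n * n + 4) * 2 ^ s * (2 * k)).
  assert (Hn3 : 1 <= n ^ (3 * s)) by (apply Nat.neq_0_lt_0, Nat.pow_nonzero; lia).
  assert (H2s : 1 <= 2 ^ s) by (apply Nat.neq_0_lt_0, Nat.pow_nonzero; lia).
  assert (HB : 8 * k <= B).
  { unfold B. transitivity (1 * 4 * 1 * (2 * k)); [lia|].
    repeat apply Nat.mul_le_mono; lia. }
  assert (HnB : n * n * n * B <= len + 4 * k).
  { transitivity (n ^ (3 * S s) * (n * n + 4) * 2 ^ S s * k); auto.
    apply Nat.eq_le_incl. unfold B.
    replace (3 * S s) with (3 + 3 * s) by lia. rewrite Nat.pow_add_r. simpl (n ^ 3).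
    simpl (2 ^ S s). ring. }
  assert (HB6 : n * n * n * (6 * k) <= n * n * n * B) by (apply Nat.mul_le_mono_l; lia).
  assert (H6 : 1 * (6 * k) <= n * n * n * (6 * k))
    by (apply Nat.mul_le_mono_r; clear -Hn; nia).
  assert (Hlk : 2 * k <= len) by lia.
  (* Rank [c] stands for a descent of [S c] words, so rank [n - 1] would give an n-division.
     Dropping the last [k] positions lets both halves of each [2 * k]-factor start inside the
     interval. *)
  destruct (few_values_subinterval (fun i => factor W i (2 * k)) lex_gt
     (fun c i => descent W (S c) i (factor W i (2 * k))) (2 * k) (n - 1)
     a (a + (len - k)) (B - 8 * k) (map (fun x => fst x ++ snd x) (list_prod V V)))
    as (a' & Ha' & He & V' & HV' & HI').
  - intros i j Hi Hj. apply lex_gt_total. rewrite !length_factor; lia.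
  - intros i Hi. apply in_map_iff. exists (factor W i k, factor W (i + k) k). split.
    + simpl fst; simpl snd. rewrite <- factor_add. f_equal. lia.
    + apply in_prod; apply HI; lia.
  - intros i Hi. apply descent_one; [apply factor_occurs|].
    intros E. apply (f_equal (@length nat)) in E. rewrite length_factor in E by lia.
    simpl in E. lia.
  - intros i Hi H. apply Hdiv. replace n with (S (n - 1)) by lia.
    eapply descent_n_divisible; eauto.
  - intros c i j Hi Hj Hij Hgt HR. apply descent_cons with j (factor W j (2 * k)); auto.
    + apply factor_occurs.
    + rewrite length_factor; lia.
  - rewrite length_map, length_prod.
    (* At most [n * n * n] blocks of length [B - 6 * k] are used; the saved [6 * k] pays for the
       [4 * k] in the bound and the dropped [k]. *)
    assert (Hq : (n - 1) * (length V * length V) + 1 <= n * n * n).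
    { assert (length V * length V <= (n - 1) * (n - 1)) by (apply Nat.mul_le_mono; lia).
      destruct n as [|q]; [lia|]. replace (S q - 1) with q in * by lia. nia. }
    assert (Hmul : ((n - 1) * (length V * length V) + 1) * (B - 8 * k + 2 * k)
             <= n * n * n * (B - 6 * k)) by (apply Nat.mul_le_mono; lia).
    rewrite Nat.mul_sub_distr_l in Hmul.
    lia.
  - apply IH with (2 * k) a' (B - 8 * k) V'; auto; try lia.
    simpl in HN. lia.
Qed.

(** At scale 1 there are at most [l] factors, so reaching fewer than [n] of them costs a factor
    [n * l]; then [few_factors] runs with [k = 1]. *)
Lemma long_word_divisible_or_power (l n d s : nat) (W : word) :
  1 <= l -> 1 <= n -> n <= d -> n * d <= 2 ^ s ->
  Forall (fun a => a < l) W ->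
  l * n ^ (3 * s + 1) * (n * n + 4) * 2 ^ s <= length W ->
  (exists w, w <> [] /\ subword (wpow w d) W) \/ n_divisible n W.
Proof.
  intros Hl Hn Hd Hs HW Hlen.
  destruct (classic (n_divisible n W)) as [Hdiv | Hdiv]; auto.
  set (B := n ^ (3 * s) * (n * n + 4) * 2 ^ s).
  assert (Hn3 : 1 <= n ^ (3 * s)) by (apply Nat.neq_0_lt_0, Nat.pow_nonzero; lia).
  assert (H2s : 1 <= 2 ^ s) by (apply Nat.neq_0_lt_0, Nat.pow_nonzero; lia).
  assert (HB : 4 <= B).
  { unfold B. transitivity (1 * 4 * 1); [lia|].
    repeat apply Nat.mul_le_mono; lia. }
  assert (HlB : n * l * B <= length W).
  { transitivity (l * n ^ (3 * s + 1) * (n * n + 4) * 2 ^ s); auto.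
    apply Nat.eq_le_incl. unfold B. rewrite Nat.pow_add_r, Nat.pow_1_r. ring. }
  destruct (few_values_subinterval (fun i => factor W i 1) lex_gt
     (fun c i => descent W (S c) i (factor W i 1)) 1 (n - 1)
     0 (length W) (B - 4) (map (fun x => [x]) (seq 0 l)))
    as (a' & Ha' & He & V' & HV' & HI').
  - intros i j Hi Hj. apply lex_gt_total. rewrite !length_factor; lia.
  (* The default 0 is never returned, as [i < length W]. *)
  - intros i Hi. apply in_map_iff. exists (nth i W 0). split.
    + assert (H : length (factor W i 1) = 1) by (apply length_factor; lia).
      unfold factor in *. rewrite <- (firstn_skipn i W) at 1.
      rewrite app_nth2; rewrite length_firstn; [|lia].
      replace (i - min i (length W)) with 0 by lia.
      destruct (skipn i W); [discriminate | auto].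
    + apply in_seq. rewrite Forall_forall in HW. split; [lia|].
      apply HW, nth_In. lia.
  - intros i Hi. apply descent_one; [apply factor_occurs|].
    intros E. apply (f_equal (@length nat)) in E. rewrite length_factor in E by lia.
    simpl in E. lia.
  - intros i Hi H. apply Hdiv. replace n with (S (n - 1)) by lia.
    eapply descent_n_divisible; eauto.
  - intros c i j Hi Hj Hij Hgt HR. apply descent_cons with j (factor W j 1); auto.
    + apply factor_occurs.
    + rewrite length_factor; lia.
  - rewrite length_map, length_seq. simpl (0 + _).
    transitivity (n * l * B); auto. apply Nat.mul_le_mono; [|lia].
    destruct n as [|q]; [lia|]. replace (S q - 1) with q by lia. lia.
  - apply few_factors with s 1 a' (B - 4) V'; auto; try lia.
Qed.

(** * Comparison with the real bound *)

Open Scope R_scope.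

Theorem theoremt2 :
  forall (l n d : nat), (1 <= l)%nat -> (1 <= n)%nat -> (n <= d)%nat ->
  forall W : word,
    Forall (fun a => (a < l)%nat) W ->
    256 * INR l
      * Rpower (INR (n * d)) (2 * log2R (INR (n * d)) + 10)
      * INR d ^ 2 <= INR (length W) ->
    (exists u : word, u <> [] /\ subword (wpow u d) W) \/ n_divisible n W.
Proof.
  intros l n d Hl Hn Hd W HW Hlen.
  set (N := (n * d)%nat) in *.
  assert (HN : (1 <= N)%nat) by (unfold N; nia).
  (* The least number of doublings from scale 1 to at least [n * d]; it gives
     [N <= 2 ^ s <= 2 * N]. *)
  set (s := Nat.log2_up N).
  assert (Hs : (N <= 2 ^ s)%nat).
  { unfold s. destruct (Nat.eq_dec N 1) as [-> | HN1]; [simpl; lia|].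
    apply Nat.log2_up_spec; lia. }
  assert (Hs' : (2 ^ s <= 2 * N)%nat).
  { unfold s. destruct (Nat.eq_dec N 1) as [-> | HN1]; [simpl; lia|].
    assert (H := Nat.log2_up_spec N ltac:(lia)).
    assert (Hp : (0 < Nat.log2_up N)%nat) by (apply Nat.log2_up_pos; lia).
    destruct (Nat.log2_up N) as [|r]; [lia|]. simpl in *. lia. }
  apply long_word_divisible_or_power with l s; auto.
  assert (HnN : (n <= N)%nat) by (unfold N; nia).
  assert (HnnN : (n * n <= N)%nat) by (unfold N; nia).
  (* As [n * n <= N], raising the exponent to [4 * s] trades [n] for [N] at half the exponent. *)
  assert (Hpow : (n ^ (3 * s) <= N ^ (2 * s))%nat).
  { transitivity (n ^ (4 * s))%nat; [apply Nat.pow_le_mono_r; lia|].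
    replace (4 * s)%nat with (2 * (2 * s))%nat by lia.
    rewrite Nat.pow_mul_r. apply Nat.pow_le_mono_l. simpl. lia. }
  assert (Hnat : (l * n ^ (3 * s + 1) * (n * n + 4) * 2 ^ s
                  <= 10 * l * N ^ (2 * s + 3))%nat).
  (* Uses [n <= N], [n * n + 4 <= 5 * N] and [2 ^ s <= 2 * N]. *)
  { transitivity (l * (N ^ (2 * s) * N) * (5 * N) * (2 * N))%nat.
    - rewrite Nat.pow_add_r, Nat.pow_1_r.
      repeat apply Nat.mul_le_mono; auto; lia.
    - rewrite Nat.pow_add_r. apply Nat.eq_le_incl. simpl (N ^ 3)%nat. ring. }
  apply INR_le. eapply Rle_trans; [|exact Hlen].
  eapply Rle_trans; [apply le_INR, Hnat|].
  rewrite !mult_INR, pow_INR.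
  assert (HNR : 1 <= INR N) by (apply (le_INR 1), HN).
  assert (HlR : 1 <= INR l) by (apply (le_INR 1), Hl).
  assert (HdR : 1 <= INR d) by (apply (le_INR 1); lia).
  assert (Hln2 : 0 < ln 2) by (rewrite <- ln_1; apply ln_increasing; lra).
  assert (HsR : INR s <= log2R (INR N) + 1).
  { unfold log2R. apply Rmult_le_reg_r with (ln 2); auto.
    replace ((ln (INR N) / ln 2 + 1) * ln 2) with (ln 2 + ln (INR N)) by (field; lra).
    rewrite <- ln_mult, <- ln_pow by lra.
    apply le_INR in Hs'. rewrite mult_INR, pow_INR, (INR_IZR_INZ 2) in Hs'. simpl IZR in Hs'.
    destruct Hs' as [Hlt | ->]; [|lra].
    apply Rlt_le, ln_increasing; [apply pow_lt |]; lra. }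
  (* By [HsR] the exponent [2 * s + 3] is at most [2 * log2R (INR N) + 5]. *)
  assert (Hexp : INR N ^ (2 * s + 3) <= Rpower (INR N) (2 * log2R (INR N) + 10)).
  { rewrite <- Rpower_pow by lra. apply Rle_Rpower; auto.
    rewrite plus_INR, mult_INR. simpl (INR 2). simpl (INR 3). lra. }
  assert (Hpos : 0 <= INR N ^ (2 * s + 3)) by (apply pow_le; lra).
  assert (Hd2 : 1 <= INR d ^ 2) by nra.
  replace (INR 10) with 10 by (simpl; lra).
  set (E := Rpower _ _) in *.
  assert (0 <= INR l * E) by (apply Rmult_le_pos; lra).
  apply Rle_trans with (256 * INR l * E); [|nra].
  rewrite !Rmult_assoc.
  assert (INR l * INR N ^ (2 * s + 3) <= INR l * E) by (apply Rmult_le_compat_l; lra).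
  lra.
Qed.
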